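(* For every integer $r\ge 2$ and every integer $n\ge 0$, $$\det\left(g^{(r)}_{i+j}\right)_{0\le i,j\le n-1}=\det\left(T^{(r)}(ri,rj)\right)_{0\le i,j\le n-1}=\det\left(T^{(r-1)}(rj-i,ri-j)\right)_{0\le i,j\le n-1}.$$
   Context: $g^{(r)}_k=\frac{1}{rk+1}\binom{(r+1)k}{k}$ is the number of $(r+1)$-ary trees with $k$ nodes. For a positive integer $r$, a $T^{(r)}$-path is a lattice path in $\mathbb Z^2$ each of whose steps is one of $(r,0),(r-1,1),\dots,(0,r)$, and $T^{(r)}(a,b)$ is the number of $T^{(r)}$-paths from $(0,0)$ to $(a,b)$ (so it is $0$ if $a<0$, $b<0$, or $r\nmid a+b$). Determinants of $0\times0$ matrices are $1$. *)

(* Defs.v *)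
From mathcomp Require Import all_boot all_order all_algebra.

Set Implicit Arguments.
Unset Strict Implicit.
Unset Printing Implicit Defensive.

Import Order.TTheory GRing.Theory Num.Theory.
Local Open Scope ring_scope.

Definition g (r k : nat) : rat :=
  ((r * k + 1)%N)%:R^-1 * ('C((r + 1) * k, k))%:R.

Definition Tstep (r : nat) (k : 'I_r.+1) : int * int :=
  ((r - k)%N%:Z, (k : nat)%:Z).

(* A path starting at the origin is given by its list of steps; it ends at the
   sum of the steps, taken in int * int. *)
Definition is_Tpath (r : nat) (a b : int) (p : seq (int * int)) : bool :=
  all [in codom (@Tstep r)] p && (\sum_(s <- p) s == (a, b)).

(* The number of T^(r)-paths from (0,0) to (a,b).  For r > 0, a path with m
   steps ends on the line x + y = r m, so bounding m by |a| + |b| loses no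
   path; see T_count. *)
Definition T (r : nat) (a b : int) : nat :=
  \sum_(m < (`|a| + `|b|).+1)
    #|[set s : m.-tuple 'I_r.+1 | is_Tpath r a b (map (@Tstep r) s)]|.

Lemma Tstep_inj r : injective (@Tstep r).
Proof. by move=> i j [_ eq_ij]; apply: val_inj. Qed.

Lemma size_Tpath r a b p :
  (0 < r)%N -> is_Tpath r a b p -> (size p <= `|a| + `|b|)%N.
Proof.
move=> r_gt0 /andP[stepP /eqP sum_p].
have: a + b = (r * size p)%N.
  have [-> ->]: a = (\sum_(s <- p) s).1 /\ b = (\sum_(s <- p) s).2.
    by rewrite sum_p.
  elim: p stepP {sum_p} => [|s p IHp] /=; first by rewrite big_nil muln0.
  case/andP=> /codomP[k ->] /IHp; rewrite big_cons /= => IH.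
  by rewrite addrACA IH -!PoszD subnK -1?ltnS // mulnS.
move=> def_ab; apply: leq_trans (leq_pmull _ r_gt0) _.
by rewrite -lez_nat -def_ab PoszD !abszE lerD // ler_norm.
Qed.

Lemma T_count r a b : (0 < r)%N ->
  exists ps : seq (seq (int * int)),
    [/\ uniq ps, forall p, (p \in ps) = is_Tpath r a b p & size ps = T r a b].
Proof.
move=> r_gt0.
pose A m := [set s : m.-tuple 'I_r.+1 | is_Tpath r a b (map (@Tstep r) s)].
pose L m := [seq map (@Tstep r) (tval s) | s <- enum (A m)].
have inL m p : (p \in L m) = (size p == m) && is_Tpath r a b p.
  apply/mapP/andP=> [[s]|[/eqP sz_p pathP]].
    by rewrite mem_enum inE => ? ->; rewrite size_map size_tuple.
  case/andP: (pathP) => /allP stepP _.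
  have [s def_p]: exists s, p = map (@Tstep r) s.
    elim: p stepP {sz_p pathP} => [|x p IHp] stepP; first by exists [::].
    have /codomP[k ->] := stepP x (mem_head _ _).
    have [|s ->] := IHp; last by exists (k :: s).
    by move=> y yp; apply: stepP; rewrite inE yp orbT.
  have sz_s: size s == m by rewrite -sz_p def_p size_map.
  by exists (Tuple sz_s) => //; rewrite mem_enum inE /= -def_p.
have uniqL m : uniq (L m).
  rewrite map_inj_uniq ?enum_uniq // => s t eq_st.
  by apply: val_inj; apply: (inj_map (@Tstep_inj r)).
exists (flatten [seq L m | m <- iota 0 (`|a| + `|b|).+1]); split.
- elim: (_.+1) 0%N => //= n IHn m; rewrite cat_uniq uniqL IHn andbT /=.
  apply/hasPn=> p /flattenP[_ /mapP[k + ->]]; rewrite mem_iota inL.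
  case/andP=> lt_mk _ /andP[/eqP sz_p _].
  by rewrite inL sz_p gtn_eqF.
- move=> p; apply/flattenP/idP=> [[_ /mapP[m _ ->]]|pathP].
    by rewrite inL => /andP[].
  exists (L (size p)); last by rewrite inL eqxx.
  by apply: map_f; rewrite mem_iota add0n ltnS (size_Tpath r_gt0 pathP).
rewrite size_flatten /shape -map_comp sumnE big_map /T.
rewrite -(big_mkord xpredT (fun m => #|A m|)) /index_iota subn0.
by apply: eq_bigr => m _; rewrite /= size_map cardE.
Qed.

(* Main.v *)
Require Import Defs.
From mathcomp Require Import all_boot all_order all_algebra.
From mathcomp Require Import zify ring.

Import Order.TTheory GRing.Theory Num.Theory.

Local Open Scope ring_scope.

(** Each of the two equalities comes from a congruence [M' = L M L^T] with [L]
    lower unitriangular, so that the determinants agree.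

    A T^(r)-path with [m] steps ends at [(a, b)] exactly when [a + b = r m] and
    its steps climb [b] in total; hence T^(r)(a, b) is the coefficient of [y^b]
    in [phi_r^m], where [phi_r = 1 + y + ... + y^r] is [geom r.+1] ([T_coef]).

    For the second equality, [phi_r] splits in two ways,
    [phi_r = 1 + y phi_(r-1) = phi_(r-1) + y^r].  Using the first splitting for
    [i] of the factors of [phi_r^(i+j)] and the second one for the other [j]
    gives ([T_binomial])
      [T^(r)(ri, rj) = sum_(k,l) C(i,k) C(j,l) T^(r-1)(rk-l, rl-k)],
    which is a congruence between the second matrix and the transpose of the
    third one, by the Pascal matrix.

    The first equality is a substitution in generating functions.  The series
    [G(x) = sum_k g_k x^k] satisfies [G(x(1-x)^r) = 1/(1-x)], so putting
    [x(1-x)^r] for [x] and [y(1-y)^r] for [y] in the generating function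
    [(x G(x) - y G(y)) / (x - y)] of the Hankel matrix gives
      [(x(1-x)^(r-1) - y(1-y)^(r-1)) / (x(1-x)^r - y(1-y)^r)],
    which is also the generating function of the numbers T^(r)(ri, rj).  The
    substitution is the congruence by [L i k = [x^i] (x(1-x)^r)^k].
    Instead of handling bivariate series, the proof characterises the
    coefficients of this quotient: row 0 and column 0 consist of ones, and for
    positive indices multiplication by [x(1-x)^r] and by [y(1-y)^r] have the
    same effect.  These two conditions determine a matrix
    ([exchange_eq0]).  The Hankel side meets the second one for every sequence
    of moments ([Hankel_pullback_exchange]); meeting the first one is the
    functional equation of [G], which is obtained from the closed form of [g]
    by finite differences ([sum_subst_g]).  The path side meets the second one
    because [y(1 - y^r t) - (1 - t)] is divisible by [1 - phi_r t]
    ([geom_exp_exchange]). *)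

(** * Determinants and congruence *)

Lemma det_congruence (R : comPzRingType) n (L M : nat -> nat -> R) :
    (forall i k, (i < k)%N -> L i k = 0) -> (forall i, L i i = 1) ->
  \det (\matrix_(i < n, j < n)
          \sum_(k < n) \sum_(l < n) L i k * L j l * M k l) =
  \det (\matrix_(i < n, j < n) M i j).
Proof.
move=> L0 L1; pose A : 'M[R]_n := \matrix_(i, k) L i k.
have detA : \det A = 1.
  rewrite det_trig ?big1 // => [i _|]; first by rewrite mxE.
  by apply/is_trig_mxP=> i j lt_ij; rewrite mxE L0.
set B := \matrix_(i, j) M i j.
transitivity (\det (A *m B *m A^T)); last first.
  by rewrite !det_mulmx det_tr detA mul1r mulr1.
congr (\det _); apply/matrixP=> i j; rewrite !mxE exchange_big /=.
apply: eq_bigr => l _; rewrite !mxE mulr_suml.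
by apply: eq_bigr => k _; rewrite !mxE mulrAC.
Qed.

(** * Paths as coefficients of powers of a geometric sum *)

Definition geom (n : nat) : {poly rat} := \sum_(k < n) 'X^k.

Lemma geomS n : geom n.+1 = geom n + 'X^n.
Proof. by rewrite /geom big_ord_recr. Qed.

Lemma geomSl n : geom n.+1 = 1 + 'X * geom n.
Proof.
rewrite /geom big_ord_recl expr0 mulr_sumr; congr (_ + _).
by apply: eq_bigr => k _; rewrite -exprS.
Qed.

Lemma geom_closed n : (1 - 'X) * geom n = 1 - 'X^n.
Proof. by rewrite -opprB mulNr -subrX1 opprB. Qed.

(** Expanding the power chooses an exponent in each factor; such a choice is the
    list of the rises of the steps of a path. *)
Lemma geom_exp n m :
  geom n ^+ m = \sum_(s : m.-tuple 'I_n) 'X^(\sum_(k <- s) k)%N.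
Proof.
rewrite -[m in LHS](card_ord m) -prodr_const.
rewrite (bigA_distr_bigA (fun _ k => 'X^(nat_of_ord k))).
rewrite (reindex_onto (@finfun_of_tuple _ m) (@tuple_of_finfun _ m)) /=; last first.
  by move=> f _; rewrite tuple_of_finfunK.
apply: eq_big => [s|s _]; first by rewrite finfun_of_tupleK eqxx.
rewrite -(big_morph (fun k => 'X^k : {poly rat}) (@exprD _ 'X) (expr0 'X)).
by rewrite big_tuple; congr ('X^_); apply: eq_bigr => i _; rewrite ffunE.
Qed.

Lemma geom_poly n : geom n = \poly_(k < n) 1.
Proof. by rewrite poly_def; apply: eq_bigr => k _; rewrite scale1r. Qed.

Lemma size_geom n : size (geom n) = n.
Proof.
case: n => [|n]; first by rewrite geom_poly; apply/eqP; rewrite -leqn0 size_poly.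
by rewrite geom_poly size_poly_eq ?oner_neq0.
Qed.

Lemma monic_geom n : geom n.+1 \is monic.
Proof. by rewrite monicE lead_coefE size_geom geom_poly coef_poly ltnSn. Qed.

Lemma size_geom_exp n m : size (geom n.+1 ^+ m) = (n * m).+1.
Proof.
have := size_exp (geom n.+1) m; rewrite size_geom /= => <-.
by rewrite prednK // lt0n size_poly_eq0 monic_neq0 ?monic_exp ?monic_geom.
Qed.

Lemma sum_Tstep r (s : seq 'I_r.+1) :
  \sum_(x <- map (@Tstep r) s) x =
  ((r * size s)%N%:Z - (\sum_(k <- s) k)%N%:Z, (\sum_(k <- s) k)%N%:Z).
Proof.
elim: s => [|k s IHs]; first by rewrite !big_nil muln0.
rewrite /= !big_cons IHs /= /Tstep; congr (_, _) => /=.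
have := ltn_ord k; lia.
Qed.

Lemma is_Tpath_map r a b (s : seq 'I_r.+1) :
  is_Tpath r a b (map (@Tstep r) s) =
  (a + b == (r * size s)%N%:Z) && (b == (\sum_(k <- s) k)%N%:Z).
Proof.
rewrite /is_Tpath sum_Tstep xpair_eqE.
have -> /= : all [in codom (@Tstep r)] (map (@Tstep r) s).
  by apply/allP=> _ /mapP[k _ ->]; apply: codom_f.
lia.
Qed.

(** A path to [(a, b)] has exactly [m] steps, and [a] is determined by [b], so
    only the height [b] has to be counted.  The shift by [l] lets the statement
    cover negative [b], for which both sides vanish. *)
Lemma T_coef r (a b : int) (m l c : nat) :
  (0 < r)%N -> a + b = (r * m)%N%:Z -> b + l%:Z = c%:Z ->
  (T r a b)%:R = ('X^l * geom r.+1 ^+ m)`_c.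
Proof.
move=> r_gt0 def_m def_c.
have lt_m : (m < (`|a| + `|b|).+1)%N by nia.
rewrite /T (bigD1 (Ordinal lt_m)) //= [X in (_ + X)%N]big1 ?addn0 => [|k neq_k].
  rewrite geom_exp mulr_sumr coef_sum -sum1_card natr_sum big_mkcond /=.
  apply: eq_bigr => s _; rewrite inE is_Tpath_map size_tuple def_m eqxx /=.
  rewrite -exprD coefXn.
  set t := (\sum_(k <- s) k)%N.
  have -> : (b == t%:Z) = (c == l + t)%N by lia.
  by case: eqP.
apply/eqP; rewrite cards_eq0; apply/eqP/setP=> s.
rewrite !inE is_Tpath_map size_tuple def_m.
have : nat_of_ord k != m by rewrite -val_eqE in neq_k.
rewrite eqz_nat eqn_pmul2l // eq_sym; by move/negPf ->.
Qed.

(** * The Pascal congruence *)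

(** Both sides are the coefficient of [y^(rj)] in
    [(1 + y phi_(r-1))^i (phi_(r-1) + y^r)^j], since each factor equals
    [phi_r].  A term with [k] and [l] factors [phi_(r-1)] carries the monomial
    [y^k y^(r(j-l))], which leaves the coefficient of [y^(rl-k)] in
    [phi_(r-1)^(k+l)]. *)
Lemma T_binomial r n i j : (1 < r)%N -> (i < n)%N -> (j < n)%N ->
  (T r (r * i)%N (r * j)%N)%:R =
  \sum_(k < n) \sum_(l < n) ('C(i, k)%:R : rat) * 'C(j, l)%:R *
    (T (r - 1) ((r * k)%N%:Z - l%:Z) ((r * l)%N%:Z - k%:Z))%:R.
Proof.
case: r => [//|r]; rewrite ltnS subn1 /= => r_gt0 lt_in lt_jn.
rewrite (@T_coef _ _ _ (i + j) 0 (r.+1 * j)) ?addr0 //; last by rewrite mulnDr.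
have widen m (F : nat -> {poly rat}) : (m < n)%N ->
    \sum_(k < m.+1) F k *+ 'C(m, k) = \sum_(k < n) F k *+ 'C(m, k).
  move=> lt_mn; rewrite (big_ord_widen _ (fun k => F k *+ 'C(m, k)) lt_mn).
  rewrite big_mkcond /=; apply: eq_bigr => k _.
  by rewrite ltnS; case: leqP => // ?; rewrite bin_small.
rewrite mul1r exprD {1}geomSl exprDn.
rewrite (eq_bigr (fun k : 'I_i.+1 => ('X * geom r.+1) ^+ k *+ 'C(i, k))); last first.
  by move=> k _; rewrite expr1n mul1r.
rewrite (widen _ (fun k => ('X * geom r.+1) ^+ k)) // (geomS r.+1).
rewrite [geom _ + _]addrC exprDn.
rewrite (widen _ (fun l => 'X^(r.+1) ^+ (j - l) * geom r.+1 ^+ l)) //.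
rewrite mulr_suml coef_sum; apply: eq_bigr => k _.
rewrite mulr_sumr coef_sum; apply: eq_bigr => l _.
have [le_lj|lt_jl] := leqP l j; last first.
  by rewrite (bin_small lt_jl) !mulr0n !mulr0 mul0r coef0.
rewrite (@T_coef _ _ _ (k + l) (k + r.+1 * (j - l)) (r.+1 * j)) //; try nia.
rewrite -natrM mulr_natl -coefMn; congr (polyseq _)`_ _.
rewrite mulrnAl mulrnAr -mulrnA [('C(j, l) * _)%N]mulnC.
by congr (_ *+ _); rewrite exprMn -exprM !exprD; ring.
Qed.

(** * The functional equation of the tree series *)

(** Taking an n-th finite difference kills polynomials of degree less than
    [n].  Writing [q = q1 X + c], the constant contributes [(1-1)^(n+1) = 0],
    and [k C(n+1,k) = (n+1) C(n,k-1)] absorbs the factor [X] into the binomial. *)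
Lemma finite_difference (n : nat) (q : {poly rat}) : (size q <= n)%N ->
  \sum_(k < n.+1) (-1) ^+ k * 'C(n, k)%:R * q.[k%:R] = 0.
Proof.
elim: n q => [|n IHn] q.
  rewrite leqn0 size_poly_eq0 => /eqP->.
  by rewrite big1 // => k _; rewrite horner0 mulr0.
elim/poly_ind: q => [|q c _] size_q.
  by rewrite big1 // => k _; rewrite horner0 mulr0.
have {}size_q : (size q <= n)%N.
  have [->|nz_q] := eqVneq q 0; first by rewrite size_poly0.
  by rewrite size_MXaddC (negPf nz_q) in size_q.
under eq_bigr => k _ do rewrite hornerMXaddC mulrDr.
rewrite big_split /= -mulr_suml.
have -> : \sum_(k < n.+2) (-1) ^+ k * 'C(n.+1, k)%:R = 0 :> rat.
  transitivity ((1 - 1 : rat) ^+ n.+1); last by rewrite subrr expr0n.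
  rewrite exprBn; apply: eq_bigr => k _.
  by rewrite !expr1n !mulr1 mulr_natr.
rewrite mul0r addr0 big_ord_recl mulr0 mulr0 add0r.
have := IHn (q \Po ('X + 1%:P)).
rewrite size_comp_poly2 ?size_XaddC // => /(_ size_q) IHq.
transitivity (- n.+1%:R * 0 : rat); last exact: mulr0.
rewrite -[X in _ = _ * X]IHq mulr_sumr; apply: eq_bigr => k _.
rewrite horner_comp !hornerE /= /bump /= add1n -natr1 exprS.
have : n.+1%:R * 'C(n, k)%:R = k.+1%:R * 'C(n.+1, k.+1)%:R :> rat.
  by rewrite -!natrM mul_bin_diag.
rewrite -[k.+1%:R]natr1 => bin_k.
transitivity (- (-1) ^+ k * q.[k%:R + 1] * ((k%:R + 1) * 'C(n.+1, k.+1)%:R)).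
  by ring.
by rewrite -bin_k; ring.
Qed.

Lemma coef_1subZXn (R : comNzRingType) (u : R) n m :
  ((1 - u *: 'X) ^+ n)`_m = (-1) ^+ m * 'C(n, m)%:R * u ^+ m.
Proof.
elim: n m => [|n IHn] m.
  by rewrite coef1; case: m => [|m]; rewrite ?mulr1 // bin0n mulr0 mul0r.
rewrite exprS mulrBl mul1r coefB -scalerAl coefZ coefXM IHn.
case: m => [|m] /=; first by rewrite !bin0 mulr0 subr0.
by rewrite IHn binS natrD !exprS; ring.
Qed.

Lemma coef_1subXn (R : comNzRingType) n m :
  ((1 - 'X) ^+ n)`_m = (-1) ^+ m * 'C(n, m)%:R :> R.
Proof. by rewrite -['X]scale1r coef_1subZXn expr1n mulr1. Qed.

(** The compositional inverse of this polynomial is the series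
    [x G(x)^r], with [G] the generating series of [g r]. *)
Definition subst_poly (r : nat) : {poly rat} := 'X * (1 - 'X) ^+ r.

Lemma coef_subst_poly_exp r k j : (subst_poly r ^+ k)`_j =
  if (j < k)%N then 0 else (-1) ^+ (j - k) * 'C(r * k, j - k)%:R.
Proof. by rewrite exprMn -exprM coefXnM coef_1subXn. Qed.

Lemma horner_ffact j N : (\prod_(m < j) ('X - m%:R%:P)).[N%:R] = (N ^_ j)%:R :> rat.
Proof.
rewrite horner_prod ffact_prod natr_prod.
have [le_jN|lt_Nj] := leqP j N.
  apply: eq_bigr => m _; rewrite hornerXsubC natrB //.
  by have := ltn_ord m; lia.
rewrite (bigD1 (Ordinal lt_Nj)) //= [RHS](bigD1 (Ordinal lt_Nj)) //=.
by rewrite hornerXsubC subnn subrr !mul0r.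
Qed.

Lemma bin_trinomial a k j : (k <= j)%N ->
  ('C(a, k) * 'C(a - k, j - k) = 'C(a, j) * 'C(j, k))%N.
Proof.
move=> le_kj; have [le_ja|lt_aj] := leqP j a; last first.
  rewrite (bin_small lt_aj) mul0n.
  have [lt_ak|le_ka] := ltnP a k; first by rewrite bin_small.
  by rewrite ['C(a - k, _)]bin_small ?muln0 //; lia.
apply/eqP; rewrite -(eqn_pmul2r (fact_gt0 k)) -(eqn_pmul2r (fact_gt0 (j - k))).
rewrite -(eqn_pmul2r (fact_gt0 (a - j))); apply/eqP.
have Ek : ('C(a, k) * (k`! * (a - k)`!) = a`!)%N by apply: bin_fact; lia.
have Ej : ('C(a, j) * (j`! * (a - j)`!) = a`!)%N by apply: bin_fact; lia.
have Ekj : ('C(j, k) * (k`! * (j - k)`!) = j`!)%N by apply: bin_fact; lia.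
have Eakj : ('C(a - k, j - k) * ((j - k)`! * (a - j)`!) = (a - k)`!)%N.
  have -> : (a - j = a - k - (j - k))%N by lia.
  by apply: bin_fact; lia.
transitivity a`!; first by rewrite -Ek -Eakj; ring.
by rewrite -Ej -Ekj; ring.
Qed.

(** Let [B(x) = x(x-1)...(x-j+1)].  The polynomials [B((r+1)x)] and [B(x-1)]
    agree at [x = -1/r], where [(r+1)x = x-1]; so their difference is [rx+1]
    times a polynomial of degree less than [j], and finite differences kill the
    quotient.  Replacing [B((r+1)k)] by [B(k-1)] therefore does not change the
    sum, and [B(k-1)] vanishes for [0 < k <= j], which leaves [B(-1)]. *)
Lemma sum_bin_ffact_div r j : (0 < r)%N ->
  \sum_(k < j.+1) (-1) ^+ k * 'C(j, k)%:R *
    (((r.+1 * k) ^_ j)%:R / (r * k + 1)%:R) = (-1) ^+ j * j`!%:R :> rat.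
Proof.
move=> r_gt0.
have nz_r : r%:R != 0 :> rat by rewrite pnatr_eq0 -lt0n.
have nz k : (r * k + 1)%:R != 0 :> rat by rewrite pnatr_eq0 addn1.
pose B : {poly rat} := \prod_(m < j) ('X - m%:R%:P).
pose q := (B \Po (r.+1%:R *: 'X)) - (B \Po ('X - 1%:P)).
have size_B : size B = j.+1.
  rewrite /B -(big_mkord xpredT (fun m => 'X - m%:R%:P)) size_prod_XsubC.
  by rewrite size_iota subn0.
have size_q : (size q <= j.+1)%N.
  rewrite (leq_trans (size_polyD _ _)) // size_polyN geq_max.
  rewrite !size_comp_poly2 ?size_B ?leqnn // ?size_XsubC //.
  by rewrite size_scale ?size_polyX ?pnatr_eq0.
(* -1/r is the solution of (r + 1) x = x - 1 *)
have root_q : root q (- r%:R^-1).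
  rewrite rootE /q hornerD hornerN !horner_comp !hornerE subr_eq0.
  apply/eqP; congr (_.[_]); rewrite -natr1; field.
  exact: nz_r.
have /factor_theorem[s def_q] := root_q.
have size_s : (size s <= j)%N.
  have [->|nz_s] := eqVneq s 0; first by rewrite size_poly0.
  by move: size_q; rewrite def_q size_Mmonic ?monicXsubC // size_XsubC addn2.
have sum_s := finite_difference j s size_s.
have q_k (k : nat) : q.[k%:R] / (r * k + 1)%:R = r%:R^-1 * s.[k%:R].
  have := nz k; rewrite def_q !hornerE natrD natrM => nz_k; field.
  by rewrite nz_r nz_k.
have B_k (k : nat) : B.[(r.+1 * k)%:R] = q.[k%:R] + B.[k%:R - 1].
  by rewrite /q hornerD hornerN !horner_comp !hornerE natrM subrK.
transitivity (\sum_(k < j.+1) (-1) ^+ k * 'C(j, k)%:R *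
                 (B.[k%:R - 1] / (r * k + 1)%:R)).
  apply/eqP; rewrite -subr_eq0 -sumrB; apply/eqP.
  transitivity (r%:R^-1 * \sum_(k < j.+1) (-1) ^+ k * 'C(j, k)%:R * s.[k%:R]).
    rewrite mulr_sumr; apply: eq_bigr => k _.
    by rewrite -horner_ffact B_k [RHS]mulrCA -q_k; ring.
  by rewrite sum_s mulr0.
rewrite big_ord_recl big1 ?addr0 => [|k _]; last first.
  rewrite lift0 -[k.+1%:R]natr1 addrK /B horner_ffact.
  by rewrite ffact_small ?mul0r ?mulr0.
rewrite bin0 expr0 !mul1r sub0r muln0 divr1 /B horner_prod.
rewrite -ffactnn ffact_prod natr_prod.
rewrite -[j in (-1) ^+ j]card_ord -prodr_const -big_split.
rewrite [RHS](reindex_inj rev_ord_inj); apply: eq_bigr => m _ /=.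
have lt_mj := ltn_ord m.
rewrite hornerXsubC mulN1r -opprD; congr (- _).
by rewrite -(natrD _ 1); congr (_%:R); lia.
Qed.

(** The coefficient of [x^j] in [G(x(1-x)^r) = 1/(1-x)].  The products of
    binomials in the closed form rearrange into the alternating sum above. *)
Lemma sum_subst_g r j K : (0 < r)%N -> (j < K)%N ->
  \sum_(k < K) (subst_poly r ^+ k)`_j * g r k = 1.
Proof.
move=> r_gt0 lt_jK.
transitivity (\sum_(k < j.+1) (subst_poly r ^+ k)`_j * g r k).
  rewrite (big_ord_widen _ (fun k => (subst_poly r ^+ k)`_j * g r k) lt_jK).
  rewrite [RHS]big_mkcond; apply: eq_bigr => k _ /=.
  by rewrite ltnS; case: leqP => // lt_jk; rewrite coef_subst_poly_exp lt_jk mul0r.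
have nz_fact : j`!%:R != 0 :> rat by rewrite pnatr_eq0 -lt0n fact_gt0.
have sgn2 m : (-1 : rat) ^+ m * (-1) ^+ m = 1.
  by rewrite -exprMn mulrNN mulr1 expr1n.
transitivity ((-1) ^+ j / j`!%:R * ((-1) ^+ j * j`!%:R) : rat); last first.
  by rewrite mulrACA sgn2 mul1r mulVf.
rewrite -(sum_bin_ffact_div r) // mulr_sumr; apply: eq_bigr => k _.
have le_kj : (k <= j)%N by rewrite -ltnS.
rewrite coef_subst_poly_exp ltnNge le_kj /= /g addn1.
have := bin_trinomial (r.+1 * k) k j le_kj.
rewrite mulSn addKn -mulSn => /(congr1 (fun m => m%:R : rat)).
rewrite !natrM => tri; rewrite -bin_ffact natrM.
have -> : (-1) ^+ (j - k) = (-1) ^+ j * (-1) ^+ k :> rat.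
  by rewrite -[X in _ = (-1) ^+ X * _](subnK le_kj) exprD -mulrA sgn2 mulr1.
transitivity ((-1) ^+ j * (-1) ^+ k * (r * k).+1%:R^-1 *
   ('C(r.+1 * k, k)%:R * 'C(r * k, j - k)%:R) : rat).
  by rewrite !addn1; ring.
rewrite tri; field.
by rewrite nz_fact andbT -natrM -(natrD _ 1) pnatr_eq0.
Qed.

(** * Matrices on which two multiplications agree *)

(** Induction on the total index.  With [c = x + ...] the relation at
    [(i+2, j+1)] expresses [f (i+1) (j+1)] as [f (i+2) j] plus terms of smaller
    total index, so that one can walk along the antidiagonal down to column 0. *)
Lemma exchange_eq0 (R : nzRingType) (c : {poly R}) (f : nat -> nat -> R) :
    c`_0 = 0 -> c`_1 = 1 ->
    (forall i, f i 0 = 0) -> (forall j, f 0 j = 0) ->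
    (forall i j, \sum_(a < i.+2) c`_a * f (i.+1 - a)%N j.+1 =
                 \sum_(a < j.+2) c`_a * f i.+1 (j.+1 - a)%N) ->
  forall i j, f i j = 0.
Proof.
move=> c0 c1 f_0 f0_ f_rec i j.
have [n] := ubnP (i + j); elim: n i j => [//|n IHn] i j.
elim: j i => [//|j IHj] [//|i] lt_n.
have := f_rec i.+1 j.
rewrite [LHS]big_ord_recl [X in _ + X = _]big_ord_recl.
rewrite [RHS]big_ord_recl [X in _ = _ + X]big_ord_recl.
rewrite !lift0 /= c0 c1 !mul0r !add0r !mul1r !subn1 /=.
rewrite [X in _ + X = _]big1 => [|a _]; last first.
  by rewrite IHn ?mulr0 // /bump /=; have := ltn_ord a; lia.
rewrite [X in _ = _ + X]big1 => [|a _]; last first.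
  by rewrite IHn ?mulr0 // /bump /=; have := ltn_ord a; lia.
by rewrite !addr0 => ->; apply: IHj; lia.
Qed.

(** The congruent of the Hankel matrix of [mu] that the substitution
    [x -> x(1-x)^r] in both variables produces; the coefficients vanish for
    [k > i] and for [l > j], which makes the double series finite. *)
Definition Hankel_pullback (r : nat) (mu : nat -> rat) (i j : nat) : rat :=
  \sum_(k < i.+1) \sum_(l < j.+1)
    (subst_poly r ^+ k)`_i * (subst_poly r ^+ l)`_j * mu (k + l)%N.

Lemma Hankel_pullback_wide r mu i j K L : (i < K)%N -> (j < L)%N ->
  Hankel_pullback r mu i j =
  \sum_(k < K) \sum_(l < L)
    (subst_poly r ^+ k)`_i * (subst_poly r ^+ l)`_j * mu (k + l)%N.
Proof.
move=> lt_iK lt_jL; rewrite /Hankel_pullback.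
rewrite (big_ord_widen K (fun k => \sum_(l < j.+1)
  (subst_poly r ^+ k)`_i * (subst_poly r ^+ l)`_j * mu (k + l)%N)) // big_mkcond.
apply: eq_bigr => k _; rewrite ltnS; case: leqP => [_|lt_ik]; last first.
  by rewrite big1 // => l _; rewrite coef_subst_poly_exp lt_ik !mul0r.
rewrite (big_ord_widen L (fun l =>
  (subst_poly r ^+ k)`_i * (subst_poly r ^+ l)`_j * mu (k + l)%N)) // big_mkcond.
apply: eq_bigr => l _; rewrite ltnS; case: leqP => // lt_jl.
by rewrite [(subst_poly r ^+ l)`_j]coef_subst_poly_exp lt_jl mulr0 mul0r.
Qed.

(** Convolving with [c = x(1-x)^r] raises the exponent of [c] in one of the two variables
    by one.  As [c^0] has no coefficient of positive index, both sides are sums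
    over positive exponents only, and the moment index [k + l] does not see
    which of the exponents was raised: this is the Hankel property. *)
Lemma Hankel_pullback_exchange r mu i j :
  \sum_(a < i.+2) (subst_poly r)`_a * Hankel_pullback r mu (i.+1 - a) j.+1 =
  \sum_(a < j.+2) (subst_poly r)`_a * Hankel_pullback r mu i.+1 (j.+1 - a).
Proof.
pose c := subst_poly r; pose K := (i + j).+2.
transitivity (\sum_(k < K) \sum_(l < K)
  (c ^+ k.+1)`_i.+1 * (c ^+ l.+1)`_j.+1 * mu (k + l).+1).
  under eq_bigr => a _.
    rewrite (@Hankel_pullback_wide _ _ _ _ K K.+1) ?mulr_sumr; [|lia..].
    over.
  rewrite exchange_big /=; apply: eq_bigr => k _.
  under eq_bigr => a _ do rewrite mulr_sumr.
  rewrite exchange_big /= big_ord_recl big1 => [|a _]; last first.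
    by rewrite coef1 mulr0 mul0r mulr0.
  rewrite add0r; apply: eq_bigr => l _.
  rewrite lift0 addnS [c ^+ k.+1]exprS coefM !mulr_suml.
  by apply: eq_bigr => a _; rewrite !mulrA.
apply/esym.
under eq_bigr => a _.
  rewrite (@Hankel_pullback_wide _ _ _ _ K.+1 K) ?mulr_sumr; [|lia..].
  over.
rewrite exchange_big /= big_ord_recl big1 => [|a _]; last first.
  by rewrite big1 ?mulr0 // => l _; rewrite coef1 !mul0r.
rewrite add0r; apply: eq_bigr => k _.
under eq_bigr => a _ do rewrite mulr_sumr.
rewrite exchange_big /=; apply: eq_bigr => l _.
rewrite /bump add1n addSn [c ^+ l.+1]exprS coefM mulr_sumr mulr_suml.
by apply: eq_bigr => a _; rewrite !mulrA [_ * c`_a]mulrC.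
Qed.

(** * The path matrix *)

(** The left side is the coefficient of [t^m] in [V / (1 - p t)], read as a
    product of [V] with a geometric series. *)
Lemma synthetic_division (R : comNzRingType) (V Q : {poly R}) (p : R) m :
  V = (1 - p *: 'X) * Q -> \sum_(a < m.+1) V`_a * p ^+ (m - a) = Q`_m.
Proof.
move=> ->; elim: m => [|m IHm].
  by rewrite big_ord1 mulr1 mulrBl mul1r coefB -scalerAl coefZ coefXM mulr0 subr0.
rewrite big_ord_recr /= subnn mulr1.
transitivity (p * Q`_m + ((1 - p *: 'X) * Q)`_m.+1).
  rewrite -IHm mulr_sumr; congr (_ + _); apply: eq_bigr => a _.
  by rewrite subSn -1?ltnS // exprS mulrCA.
by rewrite mulrBl mul1r coefB -scalerAl coefZ coefXM /= addrC subrK.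
Qed.

(** With [m = i + j + 2] and [e = r(j+1)], the difference of the two sides is,
    up to sign, the coefficient of [t^m y^e] in [V / (1 - phi_r t)], where
    [V = t (A^r - B^r)], [A = y(1 - y^r t)] and [B = 1 - t].  Since [A - B = (y - 1)(1 - phi_r t)],
    the quotient is
    [t (y - 1) (A^(r-1) + A^(r-2) B + ... + B^(r-1))].  Up to the monomials
    [y^(r-k)] and [y^(r-1-k)], the term of index [k] is a polynomial in [y^r]
    and [t]; as [r] divides [e], only [y A^(r-1)] and [B^(r-1)] can contribute,
    and their exponents of [y] are [r m] and [0], both different from [e]. *)
Lemma geom_exp_exchange r i j : (0 < r)%N ->
  let M i j := (geom r.+1 ^+ (i + j))`_(r * j) in
  \sum_(a < i.+2) (subst_poly r)`_a * M (i.+1 - a)%N j.+1 =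
  \sum_(a < j.+2) (subst_poly r)`_a * M i.+1 (j.+1 - a)%N.
Proof.
move=> r_gt0 /=; set c := subst_poly r; set m := (i.+1 + j.+1)%N.
set e := (r * j.+1)%N.
transitivity (\sum_(a < m.+1) c`_a * (geom r.+1 ^+ (m - a))`_e).
  (* for a > i + 1 the power has degree less than e *)
  rewrite (big_ord_widen m.+1
    (fun a => c`_a * (geom r.+1 ^+ (i.+1 - a + j.+1))`_e)); last by lia.
  rewrite big_mkcond; apply: eq_bigr => a _ /=.
  rewrite ltnS; case: leqP => [le_ai|lt_ia]; first by rewrite addnBAC.
  rewrite [X in _ * X]nth_default ?mulr0 // size_geom_exp ltn_pmul2l // /m.
  by move: (nat_of_ord a) lt_ia => b; lia.
apply/esym.
transitivity (\sum_(a < m.+1) c`_a * ('X^(r * a) * geom r.+1 ^+ (m - a))`_e).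
  rewrite (big_ord_widen m.+1
    (fun a => c`_a * (geom r.+1 ^+ (i.+1 + (j.+1 - a)))`_(r * (j.+1 - a))));
    last by lia.
  rewrite big_mkcond; apply: eq_bigr => a _ /=.
  rewrite ltnS coefXnM ltn_pmul2l // ltnNge.
  case: leqP => le_aj /=; last by rewrite mulr0.
  by rewrite addnBA // -mulnBr.
pose y : {poly rat} := 'X.
pose A : {poly {poly rat}} := y *: (1 - y ^+ r *: 'X).
pose S : {poly {poly rat}} := \sum_(k < r) A ^+ (r.-1 - k) * (1 - 'X) ^+ k.
pose V : {poly {poly rat}} := 'X * (A ^+ r - (1 - 'X) ^+ r).
have def_V : V = (1 - geom r.+1 *: 'X) * ((y - 1) *: ('X * S)).
  rewrite /V subrXX -/S.
  have -> : A - (1 - 'X) = (y - 1) *: (1 - geom r.+1 *: 'X).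
    rewrite /A !scalerBr !scalerA -exprS.
    have -> : y ^+ r.+1 = 1 + (y - 1) * geom r.+1.
      by rewrite -opprB mulNr geom_closed /y; ring.
    rewrite scalerDl scalerBl !scale1r; ring.
  by rewrite -scalerAl -!scalerAr; congr (_ *: _); rewrite mulrCA.
have coefV a : V`_a = c`_a *: (y ^+ (r * a) - 1).
  case: a => [|a]; first by rewrite /c /subst_poly !coefXM muln0 subrr scaler0.
  rewrite /c /subst_poly !coefXM /= coefB exprZn coefZ coef_1subZXn !coef_1subXn.
  rewrite -mul_polyC rmorphM rmorphXn rmorphN1 rmorph_nat -exprM mulnS exprD.
  ring.
have sumV := @synthetic_division _ V _ (geom r.+1) m def_V.
apply/eqP; rewrite -subr_eq0 -sumrB; apply/eqP.
transitivity (\sum_(a < m.+1) V`_a * geom r.+1 ^+ (m - a))`_e.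
  rewrite coef_sum; apply: eq_bigr => a _.
  by rewrite coefV -scalerAl coefZ mulrBl mul1r coefB mulrBr exprnP.
rewrite sumV coefZ coefXM /=; set N := (i + j.+1)%N.
rewrite coef_sum mulr_sumr coef_sum big1 // => k _.
have lt_kr := ltn_ord k; set s := (r.-1 - k)%N.
pose P : {poly {poly rat}} := (1 - 'X *: 'X) ^+ s * (1 - 'X) ^+ k.
have coefP : (A ^+ s * (1 - 'X) ^+ k)`_N = 'X^s * (P`_N \Po 'X^r).
  rewrite /A exprZn -scalerAl coefZ; congr (_ * _).
  rewrite -(coef_map (comp_poly 'X^r)) /P rmorphM !rmorphXn /=.
  by rewrite !rmorphB /= rmorph1 map_polyZ /= map_polyX comp_polyX.
rewrite coefP mulrBl mul1r mulrA -exprS coefB !coefXnM.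
rewrite !coef_comp_poly_Xn //.
have sk : (s + k).+1 = r by rewrite subnK ?prednK // -ltnS prednK.
have e_mod t : (t <= e)%N -> (r %| e - t)%N = (r %| t)%N.
  by move=> le_te; apply: dvdn_subr => //; apply: dvdn_mulr.
(* the contribution of y * A^s * B^k, which could be nonzero for k = 0 only *)
rewrite [X in X - _](_ : _ = 0) ?sub0r; last first.
  case: ltnP => // lt_se; rewrite e_mod //.
  case: ifP => // dvd_rs.
  have def_s : s.+1 = r.
    apply/eqP; rewrite eqn_leq [(r <= _)%N]dvdn_leq // andbT.
    by rewrite -sk ltnS leq_addr.
  have k0 : nat_of_ord k = 0%N.
    by apply/eqP; rewrite -(eqn_add2l s) addn0 -eqSS sk def_s.
  rewrite def_s /e -{2}[r]muln1 -mulnBr mulKn // subn1 /=.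
  rewrite /P k0 mulr1 coef_1subZXn -signr_odd -mulrA mulr_sign mulr_natl.
  case: odd;
    by rewrite ?coefN coefMn coefXn ltn_eqF ?mul0rn ?oppr0 // leq_addl.
(* the contribution of A^s * B^k, which could be nonzero for s = 0 only *)
apply/eqP; rewrite oppr_eq0; apply/eqP.
case: ltnP => // lt_se; rewrite e_mod //.
case: ifP => // dvd_rs.
have s0 : s = 0%N.
  apply/eqP; apply: contraTT dvd_rs; rewrite -lt0n => s_gt0.
  by rewrite gtnNdvd // -sk ltnS leq_addr.
rewrite s0 subn0 /e mulKn // /P s0 mul1r coef_1subXn -signr_odd mulr_sign.
by case: odd; rewrite ?coefN -polyC_natr coefC ?oppr0.
Qed.

(** Both sides satisfy the exchange relation and equal 1 on the border: on
    the path side these are the lowest and the leading coefficient of a power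
    of [phi_r], on the Hankel side [sum_subst_g]. *)
Lemma geom_exp_Hankel_pullback r i j : (0 < r)%N ->
  (geom r.+1 ^+ (i + j))`_(r * j) = Hankel_pullback r (g r) i j.
Proof.
move=> r_gt0; apply/eqP; rewrite -subr_eq0; apply/eqP.
pose f i j := (geom r.+1 ^+ (i + j))`_(r * j) - Hankel_pullback r (g r) i j.
rewrite -/(f i j); move: i j.
apply: (@exchange_eq0 _ (subst_poly r)).
- by rewrite coefXM.
- by rewrite coefXM /= coef_1subXn bin0 mulr1.
- move=> i; rewrite /f addn0 muln0 /Hankel_pullback.
  under eq_bigr => k _ do rewrite big_ord1 coef1 mulr1 addn0.
  rewrite sum_subst_g // -horner_coef0 horner_exp geomSl hornerD hornerM hornerX mul0r.
  by rewrite addr0 hornerC expr1n subrr.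
- move=> j; rewrite /f add0n /Hankel_pullback big_ord1.
  under eq_bigr => l _ do rewrite coef1 mul1r add0n.
  rewrite sum_subst_g //.
  have /monicP := monic_exp j (monic_geom r).
  by rewrite lead_coefE size_geom_exp /= => ->; rewrite subrr.
move=> i j; rewrite /f.
under eq_bigr => a _ do rewrite mulrBr.
rewrite sumrB geom_exp_exchange // Hankel_pullback_exchange -sumrB.
by apply: eq_bigr => a _; rewrite mulrBr.
Qed.

(** * The determinant identities *)

Theorem theorem9p5 (r n : nat) (hr : (2 <= r)%N) :
  \det (\matrix_(i < n, j < n) g r (i + j)) =
  \det (\matrix_(i < n, j < n) ((T r (r * i)%N%:Z (r * j)%N%:Z)%:R : rat)) /\
  \det (\matrix_(i < n, j < n) ((T r (r * i)%N%:Z (r * j)%N%:Z)%:R : rat)) =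
  \det (\matrix_(i < n, j < n)
    ((T (r - 1) ((r * j)%N%:Z - (i : nat)%:Z)
                ((r * i)%N%:Z - (j : nat)%:Z))%:R : rat)).
Proof.
have r_gt0 : (0 < r)%N by apply: ltnW.
split.
  rewrite -(@det_congruence _ n (fun i k => (subst_poly r ^+ k)`_i)
                              (fun k l => g r (k + l))).
  - congr (\det _); apply/matrixP=> i j; rewrite !mxE.
    rewrite (@T_coef _ _ _ (i + j) 0 (r * j)) ?addr0 // ?mul1r; last by rewrite mulnDr.
    by rewrite geom_exp_Hankel_pullback // (@Hankel_pullback_wide _ _ _ _ n n).
  - by move=> i k lt_ik; rewrite coef_subst_poly_exp lt_ik.
  - by move=> i; rewrite coef_subst_poly_exp ltnn subnn bin0 mulr1.
pose M k l : rat :=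
  (T (r - 1) ((r * k)%N%:Z - l%:Z) ((r * l)%N%:Z - k%:Z))%:R.
transitivity (\det (\matrix_(k < n, l < n) M k l)); last first.
  by rewrite -det_tr; congr (\det _); apply/matrixP=> i j; rewrite !mxE.
rewrite -(@det_congruence _ n (fun i k => 'C(i, k)%:R) M).
- by congr (\det _); apply/matrixP=> i j; rewrite !mxE (@T_binomial r n).
- by move=> i k lt_ik; rewrite bin_small.
- by move=> i; rewrite binn.
Qed.
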